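(* Each conjugacy class (in $G$) of an element of $\mathcal{R}$ has exactly two representatives in the normal form $\mathcal{N}$. Namely, the two conjugates in $\mathcal{N}$ are $[a,\beta]^n$ and $[a,\beta^{-1}]^n$, where $[a,\beta]$ is primitive, $n$ is a unique positive integer, and $\beta$ is a unique (bb)-word not of order 2.
   Context: $G=\mathbb{Z}_2*\mathbb{Z}_3$, where $a$ generates $\mathbb{Z}_2$ and $b$ generates $\mathbb{Z}_3$. A (bb)-word is a reduced word in $a,b,b^{-1}$ that begins with $b$ or $b^{-1}$ and ends with $b$ or $b^{-1}$ (a single letter $b^{\pm1}$ is allowed). $[x,y]=xyx^{-1}y^{-1}$ is the group commutator. $\mathcal{R}=\{xy : x,y \text{ distinct order 2 elements of } G\}$ is the set of reciprocal words, and $\mathcal{N}=\{[a,\gamma] : \gamma \text{ a (bb)-word}\}$ is the set of reciprocal words in normal form; explicitly, its elements are $ab^{\epsilon_1}\cdots ab^{\epsilon_t}ab^{-\epsilon_t}\cdots ab^{-\epsilon_1}$ with $t\ge1$, $\epsilon_i=\pm1$. An element of $G$ is primitive if it is not a non-trivial power of another element of $G$. *)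

(* Defs.v *)
From HB Require Import structures.
From mathcomp Require Import all_boot.

Set Implicit Arguments.
Unset Strict Implicit.
Unset Printing Implicit Defensive.

(** The free product Z/2 * Z/3 is realised as the set of reduced words in the
    letters a, b, b^-1, under concatenation followed by reduction.
    [La] is a; [Lb false] is b and [Lb true] is b^-1. *)
Inductive letter := La | Lb of bool.

Definition letter_code (x : letter) : option bool :=
  if x is Lb e then Some e else None.
Definition letter_decode (o : option bool) : letter :=
  if o is Some e then Lb e else La.
Lemma letter_codeK : cancel letter_code letter_decode. Proof. by case. Qed.
HB.instance Definition _ := Countable.copy letter (can_type letter_codeK).

Definition is_b (x : letter) : bool := if x is Lb _ then true else false.

(** a-letters and b-letters alternate. *)
Definition reduced (w : seq letter) : bool :=
  sorted (fun x y => is_b x != is_b y) w.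

(** Reduction of x w, for a reduced word w; note that b b = b^-1. *)
Definition lmul (x : letter) (w : seq letter) : seq letter :=
  match x, w with
  | La, La :: w' => w'
  | Lb e, Lb f :: w' => if e == f then Lb (~~ e) :: w' else w'
  | _, _ => x :: w
  end.

Definition wmul (u v : seq letter) : seq letter := foldr lmul v u.

Definition linv (x : letter) : letter := if x is Lb e then Lb (~~ e) else La.

Definition winv (u : seq letter) : seq letter := rev (map linv u).

Lemma reduced_tail x w : reduced (x :: w) -> reduced w.
Proof. exact: path_sorted. Qed.

Lemma reduced_lmul x w : reduced w -> reduced (lmul x w).
Proof.
case: x w => [|e] [|[|f] w] //= red_w; first exact: reduced_tail red_w.
case: (e == f); last exact: reduced_tail red_w.
by case: w red_w.
Qed.

Lemma reduced_wmul u v : reduced v -> reduced (wmul u v).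
Proof. by move=> red_v; elim: u => //= x u; apply: reduced_lmul. Qed.

Lemma reduced_winv u : reduced u -> reduced (winv u).
Proof.
rewrite /reduced /winv rev_sorted sorted_map.
by apply: sub_sorted => [[|?] [|?]].
Qed.

Lemma lmul_reduced x w : reduced (x :: w) -> lmul x w = x :: w.
Proof. by case: x w => [|e] [|[|f] w]. Qed.

Lemma lmulK x w : reduced w -> lmul (linv x) (lmul x w) = w.
Proof.
case: x w => [|e] [|[|f] w] red_w; rewrite /= ?addbb //.
- exact: (@lmul_reduced La).
- by case: e.
- by case: e.
- have [<-|ne_ef] := eqVneq e f; first by rewrite eqxx negbK.
  have -> : ~~ e = f by case: e f ne_ef {red_w} => [] [].
  exact: (@lmul_reduced (Lb f)).
Qed.

Lemma lmulbb e w : reduced w -> lmul (Lb e) (lmul (Lb e) w) = lmul (Lb (~~ e)) w.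
Proof.
case: w => [|[|f] w] red_w; rewrite /= ?eqxx //.
have [<-|ne_ef] := eqVneq e f; first by rewrite /=; case: e {red_w}.
have -> : f = ~~ e by case: e f ne_ef {red_w} => [] [].
by rewrite eqxx negbK; apply: (@lmul_reduced (Lb e)); case: w red_w.
Qed.

Lemma wmul_lmul x u v : reduced u -> reduced v ->
  wmul (lmul x u) v = lmul x (wmul u v).
Proof.
move=> red_u red_v; have red_wmul w : reduced (wmul w v) by apply: reduced_wmul.
case: x u red_u => [|e] [|[|f] u] red_u //.
  by apply/esym/(@lmulK La); apply: red_wmul.
rewrite [lmul _ (_ :: _)]/=; have [<-|ne_ef] := eqVneq e f.
  by apply/esym/lmulbb; apply: red_wmul.
have -> : e = ~~ f by case: e f ne_ef {red_u} => [] [].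
by apply/esym/(@lmulK (Lb f)); apply: red_wmul.
Qed.

Lemma wmulA u v w : reduced v -> reduced w ->
  wmul u (wmul v w) = wmul (wmul u v) w.
Proof.
move=> red_v red_w; elim: u => //= x u ->.
by rewrite wmul_lmul // reduced_wmul.
Qed.

Lemma wmul1 u : reduced u -> wmul u [::] = u.
Proof.
by elim: u => //= x u IHu red_u; rewrite IHu ?lmul_reduced ?(reduced_tail red_u).
Qed.

Lemma wmulVK u v : reduced v -> wmul (winv u) (wmul u v) = v.
Proof.
move=> red_v; elim: u => //= x u IHu.
rewrite /winv /= rev_cons /wmul foldr_rcons -/(wmul _ _) lmulK ?reduced_wmul //.
Qed.

Lemma winvK : involutive winv.
Proof.
move=> u; rewrite /winv map_rev revK -map_comp map_id_in // => [[|e]] _ //=.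
by rewrite negbK.
Qed.

Definition G : Type := {w : seq letter | reduced w}.
HB.instance Definition _ := SubType.copy G {w : seq letter | reduced w}.
HB.instance Definition _ := Choice.copy G {w : seq letter | reduced w}.

Definition G_one : G := exist _ [::] isT.
Definition G_mul (g h : G) : G :=
  exist _ (wmul (val g) (val h)) (reduced_wmul (val g) (valP h)).
Definition G_inv (g : G) : G := exist _ (winv (val g)) (reduced_winv (valP g)).

Lemma G_mulA : associative G_mul.
Proof. by move=> x y z; apply: val_inj; rewrite /= wmulA ?(valP y) ?(valP z). Qed.
Lemma G_mul1 : left_id G_one G_mul.
Proof. by move=> x; apply: val_inj. Qed.
Lemma G_mulr1 : right_id G_one G_mul.
Proof. by move=> x; apply: val_inj; apply: wmul1; apply: valP. Qed.
Lemma G_mulV : left_inverse G_one G_inv G_mul.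
Proof.
move=> x; apply: val_inj => /=.
by rewrite -{2}(wmul1 (valP x)) wmulVK.
Qed.
Lemma G_mulrV : right_inverse G_one G_inv G_mul.
Proof.
move=> x; have := G_mulV (G_inv x).
by rewrite (_ : G_inv (G_inv x) = x) //; apply: val_inj; apply: winvK.
Qed.

HB.instance Definition _ := isMonoid.Build G G_mulA G_mul1 G_mulr1.
HB.instance Definition _ := hasInv.Build G G_inv.
HB.instance Definition _ := Monoid_isGroup.Build G G_mulV G_mulrV.

Definition ga : G := exist _ [:: La] isT.
Definition gb : G := exist _ [:: Lb false] isT.

Local Open Scope group_scope.

(** The universal property of Z/2 * Z/3 = < a, b | a^2 = b^3 = 1 >. *)
Lemma ga_sq : ga ^+ 2 = 1. Proof. exact: val_inj. Qed.
Lemma gb_cube : gb ^+ 3 = 1. Proof. exact: val_inj. Qed.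

Lemma G_free_product (H : groupType) (x y : H) : x ^+ 2 = 1 -> y ^+ 3 = 1 ->
  exists f : G -> H,
    [/\ {morph f : g h / g * h}, f ga = x, f gb = y &
        forall f' : G -> H, {morph f' : g h / g * h} ->
          f' ga = x -> f' gb = y -> f' =1 f].
Proof.
move=> x2 y3.
pose ev l := if l is Lb e then (if e then y^-1 else y) else x.
pose fw w := foldr (fun l h => ev l * h) 1 w.
have xx : x * x = 1 by rewrite -expg2.
have yy : y * y = y^-1.
  by apply: (mulIg y); rewrite mulVg -y3 expgS expg2 mulgA.
have VV : y^-1 * y^-1 = y by rewrite -invgM yy invgK.
have fwl l w : fw (lmul l w) = ev l * fw w.
  case: l w => [|e] [|[|f] w] //=; first by rewrite mulgA xx mul1g.
  by case: e f => [] [] /=; rewrite mulgA ?VV ?yy ?mulVg ?mulgV ?mul1g.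
have fwM u v : fw (wmul u v) = fw u * fw v.
  by elim: u => [|l u IHu] /=; rewrite ?mul1g // fwl IHu mulgA.
exists (fun g => fw (val g)); split=> [g h|||f' f'M f'a f'b].
- exact: fwM.
- by rewrite /= mulg1.
- by rewrite /= mulg1.
have f'1 : f' 1 = 1 by apply: (mulgI (f' 1)); rewrite -f'M !mulg1.
have f'V : f' gb^-1 = y^-1.
  by apply: (mulgI y); rewrite -{1}f'b -f'M !mulgV.
case=> w; elim: w => [|l w IHw] red_w.
  by rewrite /= -f'1; congr f'; apply: val_inj.
pose gl : G := exist _ [:: l] isT.
pose gw : G := exist _ w (reduced_tail red_w).
have -> : exist _ (l :: w) red_w = gl * gw.
  by apply: val_inj; rewrite /= lmul_reduced.
rewrite f'M IHw; suff -> : f' gl = ev l by rewrite /= lmul_reduced.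
rewrite /gl.
case: l {red_w gl gw} => [|[]] /=.
- by rewrite -f'a; congr f'; apply: val_inj.
- by rewrite -f'V; congr f'; apply: val_inj.
- by rewrite -f'b; congr f'; apply: val_inj.
Qed.

Definition bb_word (g : G) : Prop :=
  is_b (head La (val g)) /\ is_b (last La (val g)).

(** The commutator x y x^-1 y^-1; the library's [[~ x, y]] is x^-1 y^-1 x y. *)
Definition comm (x y : G) : G := x * y * x^-1 * y^-1.

Definition order2 (x : G) : Prop := x <> 1 /\ x ^+ 2 = 1.

Definition conjugate (x y : G) : Prop := exists z : G, y = x ^ z.

Definition reciprocal (g : G) : Prop :=
  exists x y : G, [/\ order2 x, order2 y, x <> y & g = x * y].

Definition normal_form (g : G) : Prop :=
  exists2 gamma : G, bb_word gamma & g = comm ga gamma.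

(** The non-trivial powers are those whose exponent is not 0, 1 or -1. *)
Definition primitive (g : G) : Prop :=
  ~ exists (h : G) (m : nat), [/\ h <> g, 2 <= m & g = h ^+ m \/ g = h ^- m].

(* Main.v *)
(** Words starting with [a] and ending with [b] or [b^-1] multiply by plain
    concatenation, so the centraliser of such an [r] is infinite cyclic, generated
    by its shortest positive element [p].  If [r] is in normal form, [a] inverts
    [r], hence inverts [p]; then [a p] is an involution, hence a conjugate of [a],
    and this yields [p = [a, beta]].  If [r^z] is also in normal form, then
    [a] and [z a z^-1] both invert [r], so [a z a z^-1] is a power of [p]; since
    [a] commutes only with [1] and [a], an even power forces [r^z = r] and an
    odd power forces [r^z = [a, beta^-1]^n]. *)
Require Import Defs.
From mathcomp Require Import all_boot.

Local Open Scope group_scope.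

(** * Lengths and end letters of products of reduced words *)

Lemma reduced_cat d e u v : reduced u -> reduced v ->
  is_b (last d u) != is_b (head e v) -> reduced (u ++ v).
Proof.
case: u v => [|x u] [|y v] //=; first by rewrite cats0.
by rewrite /reduced /= cat_path /= => -> -> ->.
Qed.

Lemma wmul_cat u v : reduced (u ++ v) -> wmul u v = u ++ v.
Proof.
elim: u => //= x u IHu red_xuv.
by rewrite IHu ?lmul_reduced ?(reduced_tail red_xuv).
Qed.

Lemma size_lmul x w : (size w).-1 <= size (lmul x w) <= (size w).+1.
Proof.
case: x w => [|e] [|[|f] w] //=; try case: ifP => _ /=;
  by rewrite ?leqnn ?leqnSn // ?(leq_trans (leq_pred _)) // !leqW.
Qed.

Lemma size_wmul u v : size (wmul u v) <= size u + size v.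
Proof.
elim: u => //= x u IHu; have /andP[_ /leq_trans] := size_lmul x (wmul u v).
exact.
Qed.

(** Each letter of [u] removes at most one letter, so the last letter of [v] is never reached; the
    length bound is carried through the induction. *)
Lemma last_wmul d u v : size u < size v ->
  is_b (last d (wmul u v)) = is_b (last d v).
Proof.
move=> lt_uv; suff [] : size v - size u <= size (wmul u v) /\
    is_b (last d (wmul u v)) = is_b (last d v) by [].
elim: u lt_uv => [|x u IHu] lt_uv; first by rewrite subn0.
have {IHu} [le_size <-] := IHu (ltnW lt_uv).
have lt1 : 1 < size (wmul u v).
  by apply: leq_trans le_size; rewrite ltn_subRL addn1.
split=> /=.
  have /andP[+ _] := size_lmul x (wmul u v); apply: leq_trans.
  by rewrite subnS -!subn1 leq_sub2r.
  by case: x (wmul u v) lt1 {lt_uv} => [|e] [|[|f] [|y w]] //=; case: ifP.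
Qed.

Lemma is_b_linv x : is_b (linv x) = is_b x.
Proof. by case: x. Qed.

Lemma head_winv u : is_b (head La (winv u)) = is_b (last La u).
Proof.
by case/lastP: u => // u x; rewrite /winv map_rcons rev_rcons last_rcons is_b_linv.
Qed.

Lemma last_winv u : is_b (last La (winv u)) = is_b (head La u).
Proof. by rewrite -head_winv winvK. Qed.

Lemma size_winv u : size (winv u) = size u.
Proof. by rewrite size_rev size_map. Qed.

Lemma val_mulg (g h : G) : val (g * h) = wmul (val g) (val h).
Proof. by []. Qed.

Lemma val_invg (g : G) : val g^-1 = winv (val g).
Proof. by []. Qed.

Lemma val_mulg_cat d e (g h : G) :
  is_b (last d (val g)) != is_b (head e (val h)) ->
  val (g * h) = val g ++ val h.
Proof.
by move=> ne_gh; rewrite val_mulg wmul_cat // (reduced_cat d e) ?(valP g) ?(valP h).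
Qed.

Lemma val_eq_nil (g : G) : (val g == [::]) = (g == 1).
Proof. by rewrite -val_eqE. Qed.

(** * The monoid of positive elements *)

(* The positive elements form the free monoid on [a b] and [a b^-1]; the two
   defaults make the empty word positive. *)
Definition positive (g : G) : bool :=
  ~~ is_b (head La (val g)) && is_b (last (Lb false) (val g)).

Lemma val_posM (g h : G) : positive g -> positive h ->
  val (g * h) = val g ++ val h.
Proof.
move=> /andP[_ g_b] /andP[h_a _].
by apply: (val_mulg_cat (Lb false) La); rewrite g_b (negbTE h_a).
Qed.

Lemma posM (g h : G) : positive g -> positive h -> positive (g * h).
Proof.
move=> gP hP; rewrite /positive (val_posM _ _ gP hP) last_cat.
case/andP: gP hP => [g_a g_b] /andP[h_a h_b]; apply/andP; split.
  by case: (val g) g_a.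
by case: (val h) h_b.
Qed.

Lemma posX (g : G) n : positive g -> positive (g ^+ n).
Proof. by move=> gP; elim: n => // n IHn; rewrite expgS posM. Qed.

Lemma size_posX (g : G) n : positive g ->
  size (val (g ^+ n)) = (n * size (val g))%N.
Proof.
move=> gP; elim: n => // n IHn.
by rewrite expgS val_posM ?posX // size_cat IHn mulSn.
Qed.

Lemma size_gt0 (g : G) : (0 < size (val g)) = (g != 1).
Proof. by rewrite lt0n size_eq0 val_eq_nil. Qed.

(** No letters cancel in such a product. This excludes later that a non-trivial positive element is
    the inverse of a positive one. *)
Lemma posM_eq1 (g h : G) : positive g -> positive h -> g * h = 1 -> g = 1.
Proof.
move=> gP hP gh1; apply/eqP; rewrite -val_eq_nil.
by move: (congr1 val gh1); rewrite val_posM //; case: (val g).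
Qed.

Lemma posX_eq1 (g : G) n : positive g -> g != 1 -> g ^+ n = 1 -> n = 0.
Proof.
move=> gP g_neq1 gn1; have := size_posX g n gP; rewrite gn1 => /esym/eqP.
by rewrite muln_eq0 size_eq0 val_eq_nil (negbTE g_neq1) orbF => /eqP.
Qed.

Lemma posX_inj (g : G) : positive g -> g != 1 -> injective (natexp g).
Proof.
move=> gP g_neq1 m n eq_mn; apply/eqP; rewrite -(@eqn_pmul2r (size (val g))).
  by rewrite -!size_posX ?eq_mn.
by rewrite size_gt0.
Qed.

(** * The involution [ga] and its commutators *)

Lemma gaV : ga^-1 = ga.
Proof. exact: val_inj. Qed.

Lemma gaK : ga * ga = 1.
Proof. exact: val_inj. Qed.

Lemma val_ga_bb (g : G) : bb_word g -> val (ga * g) = La :: val g.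
Proof. by move=> [g_b _]; apply: (val_mulg_cat La La); rewrite g_b. Qed.

Lemma pos_ga_bb (g : G) : bb_word g -> positive (ga * g).
Proof.
move=> gbb; rewrite /positive val_ga_bb //=.
by case: gbb => _.
Qed.

Lemma bbV (g : G) : bb_word g -> bb_word g^-1.
Proof. by case=> hg lg; split; rewrite val_invg ?head_winv ?last_winv. Qed.

Lemma comm_ga (g : G) : comm ga g = ga * g * (ga * g^-1).
Proof. by rewrite /comm gaV mulgA. Qed.

Lemma pos_comm (g : G) : bb_word g -> positive (comm ga g).
Proof. by move=> gbb; rewrite comm_ga posM ?pos_ga_bb //; apply: bbV. Qed.

Lemma comm_neq1 (g : G) : bb_word g -> comm ga g != 1.
Proof.
move=> gbb; have gVbb := bbV g gbb.
by rewrite -val_eq_nil comm_ga val_posM ?pos_ga_bb // val_ga_bb.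
Qed.

Lemma ga_inverts_comm (g : G) : comm ga g ^ ga = (comm ga g)^-1.
Proof. by rewrite conjgE /comm !invgM !invgK !gaV !mulgA gaK mul1g. Qed.

(** If [h] starts with a b-letter, [ga * h] starts with [La] and gains a letter, while [h * ga]
    keeps the initial b-letter or loses a final [La]. A longer word starting with [La] is first
    multiplied by [ga]. *)
Lemma commute_ga (g : G) : commute ga g -> g = 1 \/ g = ga.
Proof.
have key (h : G) : is_b (head La (val h)) -> ~ commute ga h.
  move=> h_b ah; have ah_cat : val (ga * h) = La :: val h.
    by apply: (val_mulg_cat La La); rewrite h_b.
  have [h_last|h_last] := boolP (is_b (last La (val h))).
    have : val (h * ga) = val h ++ val ga.
      by apply: (val_mulg_cat La La); rewrite h_last.
    by rewrite -ah ah_cat; case: (val h) h_b => //= x w; case: x.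
  have : size (wmul (val h) [:: La]) = (size (val h)).+1.
    by rewrite -[RHS]/(size (La :: val h)) -ah_cat ah.
  move: h_last h_b {ah ah_cat}.
  case/lastP: (val h) => // w x; rewrite last_rcons; case: x => // _ _.
  rewrite size_rcons /wmul foldr_rcons /= => eq_size.
  by have := size_wmul w [::]; rewrite eq_size addn0 ltnNge leqW.
move=> ag; case: (boolP (is_b (head La (val g)))) => [/key//|].
have val_ag : val (ga * g) = lmul La (val g) by [].
have red_g : reduced (val g) by apply: (valP g).
case eq_g: (val g) red_g val_ag => [|[|e] [|[|f] w]] // _ val_ag _.
- by left; apply: val_inj.
- by right; apply: val_inj.
- case: (key (ga * g)); first by rewrite val_ag.
  exact: commuteM.
Qed.

(** * Involutions as conjugates of [ga] *)

(** Conjugation by the first letter moves it to the end, where it merges or cancels with the last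
    letter. *)
Lemma conj_shorter (g : G) : 1 < size (val g) ->
  is_b (head La (val g)) = is_b (last La (val g)) ->
  exists z : G, size (val (g ^ z)) < size (val g).
Proof.
have red_g : reduced (val g) by apply: (valP g).
case eq_g: (val g) red_g => [|x w] //.
case/lastP: w eq_g => // w y eq_g red_g _.
rewrite [head _ _]/= [last _ _]/= last_rcons => eq_xy.
pose gx : G := exist _ [:: x] isT.
pose gw : G := exist _ (rcons w y) (reduced_tail red_g).
have -> : g = gx * gw by apply: val_inj; rewrite eq_g val_mulg /= lmul_reduced.
exists gx; rewrite conjgE -mulgA mulKg.
rewrite val_mulg [val gw]/= [val gx]/= /wmul foldr_rcons /= size_rcons ltnS.
apply: leq_trans (size_wmul _ _) _; rewrite -addn1 leq_add2l.
by case: x y eq_xy {red_g eq_g gx gw} => [|e] [|f] //= _; case: ifP.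
Qed.

(** Induction on length: end letters of the same type allow a shorter conjugate, different types
    give a square without cancellation, and among single letters only [La] squares to 1. *)
Lemma order2_conj (x : G) : order2 x -> exists z : G, x = ga ^ z.
Proof.
have [n] := ubnP (size (val x)); elim: n x => // n IHn x /ltnSE le_xn [x_neq1 x2].
have [lt1|le1] := ltnP 1 (size (val x)).
  have [/(conj_shorter x lt1)[z lt_z]|ne_x] :=
      eqVneq (is_b (head La (val x))) (is_b (last La (val x))).
    have [] := IHn (x ^ z); first exact: leq_trans lt_z le_xn.
      split; first by move/eqP; rewrite conjg_eq1 => /eqP.
      by rewrite -conjXg x2 conj1g.
    by move=> t xz_t; exists (t * z^-1); rewrite conjgM -xz_t conjgK.
  have := congr1 val x2; rewrite expg2 (val_mulg_cat La La) 1?eq_sym //.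
  by case: (val x) lt1.
exists 1; rewrite conjg1; apply: val_inj.
have := congr1 val x2; rewrite expg2 val_mulg.
case eq_x: (val x) le1 => [|[|e] []] //.
- by case: x_neq1; apply: val_inj.
- by rewrite /= eqxx.
Qed.

(** * Centralisers of positive elements *)

Lemma pos_commute_take (g r : G) : positive g -> positive r -> commute g r ->
  size (val g) <= size (val r) -> val g = take (size (val g)) (val r).
Proof.
move=> gP rP gr le_gr.
have : take (size (val g)) (val (g * r)) = take (size (val g)) (val (r * g)).
  by rewrite gr.
by rewrite !val_posM // take_size_cat // takel_cat.
Qed.

(** [p] and [g] are not known to commute with each other, but both are prefixes of a long power of
    [r]. The rest of [g] is positive because a non-empty [p] ends in a b-letter. *)
Lemma pos_commute_div (p g r : G) :
  positive p -> positive g -> positive r -> r != 1 ->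
  commute p r -> commute g r -> size (val p) <= size (val g) ->
  exists2 h : G, positive h & g = p * h.
Proof.
move=> pP gP rP r_neq1 pr gr le_pg.
pose R := r ^+ size (val g); have RP : positive R by apply: posX.
have le_gR : size (val g) <= size (val R).
  by rewrite size_posX // leq_pmulr // size_gt0.
have p_take : val p = take (size (val p)) (val g).
  rewrite (pos_commute_take g R) ?take_takel //; last exact: commuteX.
  by apply: pos_commute_take; rewrite // ?(leq_trans le_pg) //; apply: commuteX.
pose w := drop (size (val p)) (val g).
have gE : val g = val p ++ w by rewrite p_take cat_take_drop.
have red_g : reduced (val g) by apply: (valP g).
have red_w : reduced w by apply: drop_sorted.
pose h : G := exist _ w red_w.
exists h; last by apply: val_inj; rewrite val_mulg [val h]/= wmul_cat -?gE.
case/andP: pP gP red_g => _ p_b /andP[].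
rewrite /positive [val h]/= gE last_cat; case: (w) => [|x w']; first by [].
move: p_b; case: (val p) => [|y u] /= p_b g_a -> red_g; rewrite andbT //.
move: red_g; rewrite /reduced /= cat_path /= p_b => /and3P[_ + _].
by case: (is_b x).
Qed.

(* For large k, [r ^+ k * g = g * r ^+ k] starts with [a], because of the left
   hand side, and ends with [b] or [b^-1], because of the right hand side. *)
Lemma commute_posX_pos (g r : G) : positive r -> r != 1 -> commute g r ->
  exists k, positive (r ^+ k * g).
Proof.
move=> rP r_neq1 gr; pose k := (size (val g)).+1; exists k.
have RP : positive (r ^+ k) by apply: posX.
have lt_gR : size (val g) < size (val (r ^+ k)).
  by rewrite size_posX // leq_pmulr // size_gt0.
have gR : commute g (r ^+ k) by apply: commuteX.
case/andP: RP => R_a R_b; apply/andP; split; last first.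
  by rewrite -gR val_mulg last_wmul.
rewrite -last_winv -val_invg invgM val_mulg.
by rewrite last_wmul ?val_invg ?size_winv // last_winv.
Qed.

(** Positive elements commuting with [r] and no longer than [r] are prefixes of [r], so a shortest
    non-trivial one, [p], is found among the prefixes; repeated division by [p] shows that the
    positive elements of the centraliser are powers of [p]. *)
Lemma pos_centraliser (r : G) : positive r -> r != 1 ->
  exists p : G, [/\ positive p, p != 1, exists2 n, 0 < n & r = p ^+ n &
    forall g : G, commute g r -> exists k, g = p ^+ k \/ g = p ^- k].
Proof.
move=> rP r_neq1.
(* The default value 1 is rejected by the test [P]. *)
pose pk k : G := insubd (1 : G) (take k (val r)).
pose P k := [&& positive (pk k), pk k != 1 & pk k * r == r * pk k].
have pkE (g : G) : positive g -> commute g r -> size (val g) <= size (val r) ->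
    pk (size (val g)) = g.
  by move=> gP gr le_gr; rewrite /pk -pos_commute_take // valKd.
have exP : exists k, P k.
  by exists (size (val r)); rewrite /P pkE // rP r_neq1 eqxx.
case: (ex_minnP exP) => k0 /and3P[]; set p := pk k0 => pP p_neq1 /eqP pr min_k0.
have le_pk0 : size (val p) <= k0.
  rewrite /p /pk val_insubd; case: ifP => // _.
  by rewrite size_take_min geq_minl.
have le_pr : size (val p) <= size (val r).
  rewrite /p /pk val_insubd; case: ifP => // _.
  by rewrite size_take_min geq_minr.
have min_p (g : G) : positive g -> g != 1 -> commute g r ->
    size (val p) <= size (val g).
  move=> gP g_neq1 gr; have [le_gr|/ltnW] := leqP (size (val g)) (size (val r)).
    apply: leq_trans le_pk0 (min_k0 _ _).
    by rewrite /P pkE // gP g_neq1 gr eqxx.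
  exact: leq_trans.
have posE (g : G) : positive g -> commute g r -> exists k, g = p ^+ k.
  have [n] := ubnP (size (val g)); elim: n g => // n IHn g /ltnSE le_gn gP gr.
  have [->|g_neq1] := eqVneq g 1; first by exists 0.
  have [h hP gE] : exists2 h : G, positive h & g = p * h.
    by apply: (pos_commute_div p g r) => //; apply: min_p.
  have hr : commute h r.
    have -> : h = p^-1 * g by rewrite gE mulKg.
    apply/commute_sym/commuteM; last exact: commute_sym.
    exact/commuteV/commute_sym.
  have [k hE] : exists k, h = p ^+ k.
    apply: IHn => //; apply: leq_trans le_gn.
    by rewrite gE val_posM // size_cat -[X in X < _]add0n ltn_add2r size_gt0.
  by exists k.+1; rewrite gE hE expgS.
have [n rE] := posE r rP (commute_refl r).
exists p; split=> //.
  exists n => //; rewrite lt0n; apply: contraNneq r_neq1 => n0.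
  by rewrite rE n0.
(* A power of [r], hence of [p], makes [g] positive; dividing it out again leaves a power of [p] of
   either sign. *)
move=> g gr; have [k rkgP] := commute_posX_pos g r rP r_neq1 gr.
have [j rkg] : exists j, r ^+ k * g = p ^+ j.
  apply: posE => //; apply/commute_sym/commuteM; last exact: commute_sym.
  exact: commuteX.
have gE : g = p ^- (n * k) * p ^+ j by rewrite -rkg expgnA -rE mulKg.
have [le_j|/ltnW le_j] := leqP (n * k) j.
  by exists (j - n * k)%N; left; rewrite gE -{1}(subnKC le_j) expgnDr mulKg.
exists (n * k - j)%N; right; rewrite gE -{1}(subnKC le_j) expgnDr invgM.
by rewrite mulgVK.
Qed.

(** * Conjugates of [ga] and reciprocal elements *)

Lemma conj_ga_fix (z : G) : ga ^ z = ga -> z = 1 \/ z = ga.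
Proof. by move/conjg_fixP/commgP/commute_ga. Qed.

Lemma conj_ga_ga : ga ^ ga = ga.
Proof. exact: val_inj. Qed.

Lemma comm_ga_conj (g : G) : comm ga g = ga * ga ^ g^-1.
Proof. by rewrite /comm conjgE gaV invgK !mulgA. Qed.

(** The type of the last letter is recorded so that the stripping can be repeated on the inverse. *)
Lemma strip_ga (t : G) : [\/ t = 1, t = ga | exists s : G,
  [/\ s = t \/ s = ga * t, is_b (head La (val s)) &
      is_b (last La (val s)) = is_b (last La (val t))]].
Proof.
have val_at : val (ga * t) = lmul La (val t) by [].
have red_t : reduced (val t) by apply: (valP t).
case eq_t: (val t) red_t val_at => [|[|e] w] red_t val_at.
- by apply: Or31; apply: val_inj.
- case: w red_t eq_t val_at => [|[|e] w] // red_t eq_t val_at.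
    by apply: Or32; apply: val_inj.
  by apply: Or33; exists (ga * t); split; [right | rewrite val_at | rewrite val_at].
- by apply: Or33; exists t; split; [left | rewrite eq_t | rewrite eq_t].
Qed.

Lemma conj_ga_bb (t : G) : ga ^ t = ga \/ exists2 g : G, bb_word g &
  ga ^ t = ga ^ g^-1 \/ ga ^ t = ga ^ (g^-1 * ga).
Proof.
case: (strip_ga t) => [->|->|[s [st s_b _]]]; rewrite ?conjg1 ?conj_ga_ga; auto.
have -> : ga ^ t = ga ^ s by case: st => ->; rewrite // conjgM conj_ga_ga.
right; case: (strip_ga s^-1) => [sV|sV|[u [us u_b]]].
- by move: s_b; rewrite -(invgK s) sV invg1.
- by move: s_b; rewrite -(invgK s) sV gaV.
rewrite val_invg last_winv s_b => lu_b; exists u; first by split; rewrite ?lu_b.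
case: us => ->; first by left; rewrite invgK.
by right; rewrite invgM invgK gaV -mulgA gaK mulg1.
Qed.

Lemma conj_comm_ga (g : G) : ga * ga ^ (g^-1 * ga) = (comm ga g)^-1.
Proof. by rewrite -ga_inverts_comm comm_ga_conj conjMg conj_ga_ga conjgM. Qed.

(** Conjugating the first involution to [ga] leaves a commutator or its inverse, and [ga] conjugates
    the inverse back. *)
Lemma reciprocal_conj_comm (r : G) : reciprocal r ->
  exists z g : G, bb_word g /\ r ^ z = comm ga g.
Proof.
case=> x [y [/order2_conj[u ->] /order2_conj[v ->] ne_uv ->]].
have conjE : (ga ^ u * ga ^ v) ^ u^-1 = ga * ga ^ (v * u^-1).
  by rewrite conjMg conjgK conjgM.
case: (conj_ga_bb (v * u^-1)) => [eq_a|[g gbb [eq_g|eq_g]]].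
- by case: ne_uv; rewrite -[in LHS]eq_a conjgM conjgKV.
- by exists u^-1, g; rewrite conjE eq_g comm_ga_conj.
- exists (u^-1 * ga), g; split=> //.
  by rewrite conjgM conjE eq_g conj_comm_ga conjVg ga_inverts_comm invgK.
Qed.

(** * Normal forms, their roots and their conjugates *)

Lemma pos_inverted_comm (g : G) : positive g -> g != 1 -> g ^ ga = g^-1 ->
  exists2 h : G, bb_word h & g = comm ga h.
Proof.
move=> gP g_neq1 ginv.
have ag_ord2 : order2 (ga * g).
  split; first by move/mulg1_eq; rewrite gaV => eq_g; rewrite -eq_g in gP.
  have -> : (ga * g) ^+ 2 = g ^ ga * g by rewrite conjgE gaV expg2 !mulgA.
  by rewrite ginv mulVg.
case: (order2_conj _ ag_ord2) => t agE.
have gE : g = ga * ga ^ t by rewrite -agE mulgA gaK mul1g.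
case: (conj_ga_bb t) => [eq_a|[h hbb [eq_h|eq_h]]].
- by move: g_neq1; rewrite gE eq_a gaK eqxx.
- by exists h; rewrite // gE eq_h comm_ga_conj.
(* Here [g] would be the inverse of a positive commutator. *)
- case/eqP: g_neq1; apply: (posM_eq1 g (comm ga h)) => //; first exact: pos_comm.
  by rewrite gE eq_h conj_comm_ga mulVg.
Qed.

(** [g^-1 * h] commutes with [ga], so it is 1 or [ga]; in the latter case [h] would end in [La]. *)
Lemma comm_ga_inj (g h : G) : bb_word g -> bb_word h ->
  comm ga g = comm ga h -> g = h.
Proof.
move=> gbb hbb; rewrite !comm_ga_conj => /mulgI eq_gh.
have /conj_ga_fix[] : ga ^ (g^-1 * h) = ga by rewrite conjgM eq_gh conjgKV.
  by move/mulg1_eq; rewrite invgK.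
move=> ghE; have hE : h = g * ga by rewrite -ghE mulVKg.
case: gbb hbb => [_ g_b] [_]; rewrite hE (val_mulg_cat La La) ?g_b //.
by rewrite last_cat.
Qed.

Lemma normal_form_inverted (g : G) : normal_form g ->
  [/\ positive g, g != 1 & g ^ ga = g^-1].
Proof.
by case=> h hbb ->; rewrite pos_comm // comm_neq1 // ga_inverts_comm.
Qed.

(** Normal forms are exactly the non-trivial positive elements inverted by [ga], a property that
    passes to positive powers. *)
Lemma normal_formX (g : G) n : normal_form g -> 0 < n -> normal_form (g ^+ n).
Proof.
case/normal_form_inverted => gP g_neq1 ginv n_gt0.
have [||h hbb ->] := pos_inverted_comm (g ^+ n) (posX _ _ gP); last by exists h.
- by apply: contraTneq n_gt0 => /posX_eq1 ->.
- by rewrite conjXg ginv expVgn.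
Qed.

(** A further conjugation by [ga] removes the outer inverse: this is the source of the second
    representative. *)
Lemma conj_comm_bb (g : G) : comm ga g ^ g = (comm ga g^-1)^-1.
Proof. by rewrite conjgE /comm !invgM !invgK !gaV !mulgA mulgVK. Qed.

Lemma normal_form_root (r : G) : normal_form r ->
  exists (b : G) (n : nat), [/\ bb_word b, 0 < n, r = comm ga b ^+ n &
    forall g : G, commute g r ->
      exists k, g = comm ga b ^+ k \/ g = comm ga b ^- k].
Proof.
case/normal_form_inverted => rP r_neq1 rinv.
have [p [pP p_neq1 [n n_gt0 rE] centr]] := pos_centraliser r rP r_neq1.
suff pinv : p ^ ga = p^-1.
  have [b bbb pE] := pos_inverted_comm p pP p_neq1 pinv.
  by exists b, n; split; rewrite -?pE.
have pr : commute p r by rewrite rE; apply: commuteX.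
have par : commute (p ^ ga) r.
  have raV : r = r^-1 ^ ga by rewrite conjVg rinv invgK.
  have prV : p * r^-1 = r^-1 * p by apply: commuteV.
  by rewrite /commute raV -!conjMg prV.
(* Taking [n]-th powers turns [p] into [r], so [r^-1] is [r ^+ k] or [r ^- k]; the first is
   impossible, the second forces [k = 1]. *)
have [k [paE|paE]] := centr _ par.
  suff /(posX_eq1 _ _ rP r_neq1) : r ^+ k.+1 = 1 by [].
  by rewrite expgSr {1}rE expgnAC -paE -conjXg -rE rinv mulVg.
suff k1 : k = 1%N by rewrite paE k1 expg1.
apply: (posX_inj r) => //=; apply: invg_inj.
by rewrite expg1 -rinv [in LHS]rE expgnAC -expVgn -paE -conjXg -rE.
Qed.

(* The product of [a] with the conjugate of [a] fixing the axis of [r] lies in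
   the centraliser of [r]; whether it is an even or an odd power of the root
   decides which of the two normal forms arises. *)
Lemma normal_form_conj (b r s z : G) (n : nat) : bb_word b -> 0 < n ->
  r = comm ga b ^+ n ->
  (forall g : G, commute g r ->
      exists k, g = comm ga b ^+ k \/ g = comm ga b ^- k) ->
  normal_form s -> s = r ^ z ->
  s = comm ga b ^+ n \/ s = comm ga b^-1 ^+ n.
Proof.
move=> bbb n_gt0 rE centr nf_s sE.
have [sP s_neq1 sinv] := normal_form_inverted s nf_s.
set p := comm ga b in rE centr *; set q := comm ga b^-1.
have pinv : p ^ ga = p^-1 by apply: ga_inverts_comm.
have qinv : q ^ ga = q^-1 by apply: ga_inverts_comm.
have pP : positive p by apply: pos_comm.
have qP : positive q by apply/pos_comm/bbV.
have rinv : r ^ ga = r^-1 by rewrite rE conjXg pinv expVgn.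
have not_sV (t : G) : positive t -> s <> t^-1.
  by move=> tP st; case/eqP: s_neq1; apply: (posM_eq1 s t); rewrite // st mulVg.
(* [d] is half of the power and [e] its parity. For a negative power the half is rounded up, so that
   the remainder [e] is still 0 or 1. *)
have [d [e [dp dinv cE]]] : exists (d : G) (e : bool),
    [/\ commute p d, d ^ ga = d^-1 & ga * ga ^ z^-1 = d * d * p ^+ e].
  have [|k kE] := centr (ga * ga ^ z^-1).
    apply/commute_sym/commgP/conjg_fixP.
    rewrite conjgM rinv [ga ^ _]conjgE invgK conjVg !conjgM -sE sinv conjVg invgK.
    by rewrite sE conjgK.
  have pk m : commute p (p ^+ m) by apply/commuteX/commute_refl.
  have kodd : k = (odd k + (k./2 + k./2))%N by rewrite addnn odd_double_half.
  case: kE => ->.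
    exists (p ^+ k./2), (odd k); split; rewrite ?conjXg ?pinv ?expVgn //.
    by rewrite -!expgnDr addnC -kodd.
  exists (p ^- (odd k + k./2)), (odd k); split.
  - exact/commuteV/pk.
  - by rewrite conjVg conjXg pinv expVgn.
  - rewrite -invgM -expgnDr {1}kodd.
    have -> : (odd k + k./2 + (odd k + k./2) = odd k + (odd k + (k./2 + k./2)))%N.
      by rewrite addnACA -!addnA.
    by rewrite [in RHS]expgnDr invgM mulgVK.
have rd : r ^ d = r.
  by apply/conjg_fixP/commgP; rewrite rE; apply/commute_sym/commuteX/commute_sym.
have sdz : s = r ^ (d * z) by rewrite conjgM rd.
(* Since [ga] inverts [d], the factor [d * d] turns into conjugation by [d]. *)
have azE : ga ^ z^-1 = (ga * p ^+ e) ^ d.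
  have -> : ga ^ z^-1 = ga * (d * d * p ^+ e) by rewrite -cE mulgA gaK mul1g.
  have pd : p ^+ e * d = d * p ^+ e by apply/commute_sym/commuteX/commute_sym.
  have dga : d^-1 * ga = ga * d by rewrite -dinv conjgE gaV -!mulgA gaK mulg1.
  by rewrite conjgE -!mulgA pd !mulgA dga.
(* Odd power: [ga * p] is a conjugate of [ga], so [s] is the conjugate of [q ^- n] by 1 or [ga];
   positivity excludes 1. *)
case: e {cE} azE => azE.
  have apE : ga * p = ga ^ b^-1 by rewrite /p comm_ga_conj mulgA gaK mul1g.
  have : ga ^ (b^-1 * (d * z)) = ga.
    by rewrite !conjgM -apE -[p]expg1 -azE conjgKV.
  have sbE : s = (q ^- n) ^ (b^-1 * (d * z)).
    by rewrite conjgM -expVgn -conj_comm_bb -conjXg conjgK -rE.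
  case/conj_ga_fix => bdz; rewrite bdz in sbE; [left|right].
    by case: (not_sV (q ^+ n)); rewrite ?posX // sbE conjg1.
  by rewrite sbE conjVg conjXg qinv expVgn invgK.
(* Even power: [d * z] is 1 or [ga], so [s] is [r] or its inverse, and positivity excludes the
   inverse. *)
have /conj_ga_fix[dz|dz] : ga ^ (z^-1 * d^-1) = ga.
  by rewrite conjgM azE conjgK mulg1.
- by left; rewrite sdz -[d * z]invgK invgM dz invg1 conjg1.
- by case: (not_sV r); rewrite ?rE ?posX // -rE sdz -[d * z]invgK invgM dz gaV.
Qed.

(** * The two representatives and the uniqueness of root and exponent *)

Theorem lemma3p9 (r : G) (hr : reciprocal r) :
  exists (n : nat) (beta : G),
    [/\ (0 < n)%N /\ bb_word beta,
        ~ order2 beta /\ primitive (comm ga beta),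
        comm ga beta ^+ n <> comm ga beta^-1 ^+ n,
        (forall s : G, normal_form s /\ conjugate r s <->
           s = comm ga beta ^+ n \/ s = comm ga beta^-1 ^+ n) &
        (forall (n' : nat) (beta' : G),
           (0 < n')%N -> bb_word beta' -> ~ order2 beta' ->
           primitive (comm ga beta') ->
           conjugate r (comm ga beta' ^+ n') ->
           n' = n /\ (beta' = beta \/ beta' = beta^-1))].
Proof.
have [z0 [g [gbb r0E]]] := reciprocal_conj_comm r hr.
have [b [n [bbb n_gt0 rE centr]]] :
  exists (b : G) (n : nat), [/\ bb_word b, 0 < n, r ^ z0 = comm ga b ^+ n &
    forall g : G, commute g (r ^ z0) ->
      exists k, g = comm ga b ^+ k \/ g = comm ga b ^- k].
  by apply: normal_form_root; exists g.
set p := comm ga b in rE centr; set q := comm ga b^-1.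
have bVbb := bbV b bbb.
have pP : positive p by apply: pos_comm.
have qP : positive q by apply: pos_comm.
have p_neq1 : p != 1 by apply: comm_neq1.
have q_neq1 : q != 1 by apply: comm_neq1.
have nf_p : normal_form p by exists b.
have nf_q : normal_form q by exists b^-1.
have qE : q = p ^ (b * ga).
  by rewrite conjgM conj_comm_bb conjVg ga_inverts_comm invgK.
(* A root [h] of [p] lies in the centraliser, so it is itself a power of [p], and the exponents
   cannot match. *)
have prim_p : primitive p.
  case=> h [m [_ m_gt1 pE]].
  have hr0 : commute h (r ^ z0).
    rewrite rE; apply: commuteX; case: pE => ->; last apply: commuteV;
    exact/commuteX/commute_refl.
  have [j [pj|pj]] : exists j, p = p ^+ (j * m) \/ p = p ^- (j * m).
    have [j hE] := centr h hr0; exists j; rewrite expgnA.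
    case: hE pE => -> []; rewrite ?expVgn ?invgK; auto.
  - have : 1%N = (j * m)%N by apply: (posX_inj p).
    by move/esym/eqP; rewrite muln_eq1 => /andP[_ /eqP m1]; rewrite m1 in m_gt1.
  - have : p ^+ (j * m).+1 = 1 by rewrite expgS {1}pj mulVg.
    by move/(posX_eq1 _ _ pP p_neq1).
(* If [b] were its own inverse, [p] would be the square of [ga * b]. *)
have not_ord2 : ~ order2 b.
  case=> _ b2; have bV : b^-1 = b by apply: mulg1_eq; rewrite -expg2.
  have pE : p = (ga * b) ^+ 2 by rewrite /p comm_ga bV expg2.
  apply: prim_p; exists (ga * b), 2; split; [|by []|by left].
  move=> ab_p; case/eqP: p_neq1.
  have : ga * b = 1 by apply: (mulIg (ga * b)); rewrite mul1g -expg2 -pE.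
  by rewrite -ab_p.
(* Equal powers would put [q] in the centraliser; comparing exponents gives [q = p], so [b] would be
   its own inverse. *)
have ne_pq : p ^+ n <> q ^+ n.
  move=> pq; have [k qk] : exists k, q = p ^+ k \/ q = p ^- k.
    by apply: centr; rewrite rE pq; apply/commuteX/commute_refl.
  case: qk => qk; last first.
    case/eqP: q_neq1; apply: (posM_eq1 q (p ^+ k)); rewrite ?posX //.
    by rewrite qk mulVg.
  have : (k * n)%N = n by apply: (posX_inj p) => //=; rewrite expgnA -qk.
  rewrite -[X in _ = X -> _]mul1n => /eqP; rewrite eqn_pmul2r // => /eqP k1.
  have bE : b = b^-1 by apply: comm_ga_inj; rewrite // -/q qk k1 expg1.
  apply: not_ord2; split; last by rewrite expg2 {1}bE mulVg.
  by move=> b1; move: bbb => []; rewrite b1.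
have conj_pn (s : G) : normal_form s -> conjugate r s -> s = p ^+ n \/ s = q ^+ n.
  move=> nf_s [z sE]; apply: (normal_form_conj b (r ^ z0) s (z0^-1 * z)) => //.
  by rewrite sE conjgM conjgK.
exists n, b; split=> //.
  move=> s; split=> [[nf_s rs]|]; first exact: conj_pn.
  case=> ->; split; try exact: normal_formX.
    by exists z0.
  by exists (z0 * (b * ga)); rewrite conjgM rE conjXg -qE.
move=> n' b' n'_gt0 b'bb _ prim_p' rp'.
set p' := comm ga b' in prim_p' rp'.
have p'P : positive p' by apply: pos_comm.
have p'_neq1 : p' != 1 by apply: comm_neq1.
(* Stated for a conjugate of [p] to serve both [b] and [b^-1]. Transporting the centraliser by [x]
   makes [p'] a power of [q1], and primitivity leaves only exponent 1. *)
have key (b1 x : G) : bb_word b1 -> comm ga b1 = p ^ x ->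
    p' ^+ n' = comm ga b1 ^+ n -> n' = n /\ b' = b1.
  move=> b1bb; have := comm_neq1 b1 b1bb; have := pos_comm b1 b1bb.
  set q1 := comm ga b1 => q1P q1_neq1 q1E eq_pow.
  have [k p'k] : exists k, p' = q1 ^+ k \/ p' = q1 ^- k.
    have [|k kE] := centr (p' ^ x^-1).
      rewrite rE -[p](conjgK x) -q1E -conjXg -eq_pow conjXg.
      exact/commuteX/commute_refl.
    exists k; rewrite q1E -conjXg -conjVg.
    by case: kE => <-; rewrite conjgKV; [left|right].
  case: p'k => p'k; last first.
    case/eqP: p'_neq1; apply: (posM_eq1 p' (q1 ^+ k)); rewrite ?posX //.
    by rewrite p'k mulVg.
  case: k p'k => [p'1|[p'q1|k p'k]].
  - by rewrite p'1 eqxx in p'_neq1.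
  - have {}p'q1 : p' = q1 by rewrite p'q1.
    split; last exact: comm_ga_inj.
    by apply: (posX_inj q1) => //=; rewrite -eq_pow p'q1.
  - case: prim_p'; exists q1, k.+2; split=> //; last by left.
    move=> q1p'; have : 1%N = k.+2 by apply: (posX_inj q1); rewrite //= -p'k q1p'.
    by [].
have nf_p' : normal_form (p' ^+ n') by apply: normal_formX => //; exists b'.
case: (conj_pn _ nf_p' rp') => eq_pow.
  have [|//|-> ->] := key b 1 bbb; [by rewrite conjg1 | by split; auto].
have [//|//|-> ->] := key b^-1 (b * ga) bVbb; by split; auto.
Qed.
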